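(* Let $b>1$ and $n\in\mathbb N$. Then the (unique) best $d_1$-approximation $\delta_\bullet^{\bullet,n}$ of $\beta_b$ is $\delta_x^p$, with $$x_j=\left(1+\frac{j-1}n(b^{1/2}-1)\right)\left(1+\frac jn(b^{1/2}-1)\right),\qquad P_j=\frac2{\log b}\log\left(1+\frac jn(b^{1/2}-1)\right),$$ for all $j=1,\ldots,n$; in particular, $\#\,\mathrm{supp}\,\delta_\bullet^{\bullet,n}=n$. Moreover, $$d_1(\beta_b,\delta_\bullet^{\bullet,n})=\frac1{n\log b}\tanh\left(\frac{\log b}4\right).$$
   Context: For $b>1$, $\beta_b$ is the Borel probability measure on $\mathbb I=[1,b]$ with $\beta_b([1,s])=\log s/\log b$ for all $s\in[1,b[$ ($\log$ is the natural logarithm). For Borel probability measures $\mu,\nu$ on $[1,b]$ with quantile functions $F_\mu^{-1},F_\nu^{-1}:[0,1[\,\to\mathbb R$ and distribution functions $F_\mu,F_\nu$, the (normalized) $L^1$-Kantorovich distance is $$d_1(\mu,\nu)=\frac1{b-1}\int_0^1|F_\mu^{-1}(y)-F_\nu^{-1}(y)|\,dy=\frac1{b-1}\int_1^b|F_\mu(x)-F_\nu(x)|\,dx.$$ For $n\in\mathbb N$: $\Xi_n=\{x\in[1,b]^n:x_1\le\ldots\le x_n\}$, $\Pi_n=\{p\in\mathbb R^n:p_j\ge0,\sum_{j=1}^np_j=1\}$, $P_j=\sum_{i=1}^jp_i$, $\delta_x^p=\sum_{j=1}^np_j\delta_{x_j}$ with $\delta_a$ the Dirac measure at $a$. A best $d_1$-approximation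 of $\mu$ (for given $n$), denoted $\delta_\bullet^{\bullet,n}$, is a measure $\delta_x^p$ with $x\in\Xi_n$, $p\in\Pi_n$ such that $d_1(\mu,\delta_x^p)\le d_1(\mu,\delta_y^q)$ for all $y\in\Xi_n$, $q\in\Pi_n$. *)

(* Defs.v *)
From HB Require Import structures.
From mathcomp Require Import all_boot all_order all_algebra.
From mathcomp Require Import all_classical all_reals all_analysis.
Set Implicit Arguments.
Unset Strict Implicit.
Unset Printing Implicit Defensive.
Import Order.TTheory GRing.Theory Num.Theory.
Import numFieldNormedType.Exports.
Local Open Scope classical_set_scope.
Local Open Scope ring_scope.

(* The interval [1, b] is a subset of R, and Borel probability measures on it
   are Borel probability measures on R that give it full mass. *)
Notation prob R := (probability (measurableTypeR R) R).

Definition tanh {R : realType} (t : R) : R :=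
  (expR t - expR (- t)) / (expR t + expR (- t)).

Definition is_beta {R : realType} (b : R) (beta : prob R) : Prop :=
  beta `[1, b]%classic = 1%E /\
  forall s : R, 1 <= s < b -> beta `[1, s]%classic = (ln s / ln b)%:E.

Definition distr_fun {R : realType} (mu : prob R) (x : R) : R :=
  fine (mu `]-oo, x]%classic).

(* Right-continuous quantile function. If mu is carried by [1, b] and
   0 <= y < 1, the set below is nonempty (it contains ]-oo, 1[) and bounded
   above by b, so that sup is a genuine supremum, with value in [1, b]. *)
Definition quantile {R : realType} (mu : prob R) (y : R) : R :=
  sup [set x : R | distr_fun mu x <= y].

Definition d1 {R : realType} (b : R) (mu nu : prob R) : \bar R :=
  (((b - 1)^-1)%:E *
   \int[@lebesgue_measure R]_(y in `[0%R, 1%R[)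
     (`|quantile mu y - quantile nu y|)%:E)%E.

Definition Xi {R : realType} (b : R) (n : nat) (x : 'I_n -> R) : Prop :=
  (forall j, 1 <= x j <= b) /\ (forall i j : 'I_n, (i <= j)%N -> x i <= x j).

Record Pi (R : realType) (n : nat) := MkPi {
  weight :> 'I_n -> R ;
  weight_ge0 : forall j, 0 <= weight j ;
  weight_sum1 : \sum_(j < n) weight j = 1 }.

(* The index j : 'I_n is zero-based: psum p j is p_1 + ... + p_(j+1) in
   one-based notation. *)
Definition psum {R : realType} {n : nat} (p : 'I_n -> R) (j : 'I_n) : R :=
  \sum_(i < n | (i <= j)%N) p i.

Definition delta {R : realType} {n : nat} (x : 'I_n -> R) (p : Pi R n)
    (A : set (measurableTypeR R)) : \bar R :=
  (\sum_(j < n) (p j)%:E * \d_(x j : measurableTypeR R) A)%E.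

Section delta_probability.
Context {R : realType} {n : nat} (x : 'I_n -> R) (p : Pi R n).
Local Open Scope ereal_scope.

Let delta0 : delta x p set0 = 0.
Proof. by rewrite /delta big1// => j _; rewrite measure0 mule0. Qed.

Let delta_ge0 A : 0 <= delta x p A.
Proof. by apply: sume_ge0 => j _; rewrite mule_ge0// lee_fin weight_ge0. Qed.

Let delta_sigma_additive : semi_sigma_additive (delta x p).
Proof.
move=> F mF tF mUF; rewrite [X in _ --> X](_ : _ =
    lim ((fun k => \sum_(0 <= i < k) delta x p (F i)) @ \oo)).
  by apply: is_cvg_ereal_nneg_natsum => k _; exact: delta_ge0.
rewrite /delta nneseries_sum//; last first.
  by move=> j i _; rewrite mule_ge0// lee_fin weight_ge0.
apply: eq_bigr => /= j _; rewrite nneseriesZl ?lee_fin ?weight_ge0//.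
by congr (_ * _); exact: measure_semi_bigcup.
Qed.

HB.instance Definition _ := isMeasure.Build _ _ _ (delta x p)
  delta0 delta_ge0 delta_sigma_additive.

Let delta_setT : delta x p [set: _] = 1.
Proof.
rewrite /delta (eq_bigr (fun j => (p j)%:E)); last first.
  by move=> j _; rewrite diracT mule1.
by rewrite sumEFin weight_sum1.
Qed.

HB.instance Definition _ :=
  @Measure_isProbability.Build _ _ R (delta x p) delta_setT.

End delta_probability.

(* Equality of Borel measures is equality on Borel sets: the values of a
   measure record on nonmeasurable sets carry no meaning. *)
Definition eq_meas {R : realType} (mu nu : prob R) : Prop :=
  forall A, measurable A -> mu A = nu A.

Definition best_d1_approx {R : realType} (b : R) (n : nat) (mu nu : prob R) :
    Prop :=
  (exists (x : 'I_n -> R) (p : Pi R n), Xi b x /\ eq_meas nu (delta x p)) /\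
  forall (y : 'I_n -> R) (q : Pi R n), Xi b y ->
    (d1 b mu nu <= d1 b mu (delta y q))%E.

Definition msupp {R : realType} (mu : prob R) : set R :=
  [set a | forall U : set R, open U -> U a -> (0 < mu U)%E].

Lemma beta_exists (R : realType) (b : R) : 1 < b ->
  exists beta : prob R, is_beta b beta.
Proof.
move=> b1; have b0 : 0 < b by exact: lt_trans b1.
have lb0 : 0 < ln b by rewrite ln_gt0.
pose f (y : measurableTypeR R) : measurableTypeR R := expR ((y : R) * ln b).
have mf : measurable_fun [set: measurableTypeR R] f.
  apply: (measurableT_comp (f := expR)) => //.
  exact: measurable_realfun.measurable_funM.
pose Fm := isMeasurableFun.Build _ _ _ _ f mf.
pose F : {mfun measurableTypeR R >-> measurableTypeR R} := HB.pack f Fm.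
exists (distribution (uniform_prob (@ltr01 R)) F).
have key s : 1 <= s -> s <= b ->
    distribution (uniform_prob (@ltr01 R)) F `[1, s]%classic = (ln s / ln b)%:E.
  move=> s1 sb; have s0 : 0 < s by exact: lt_le_trans s1.
  have ls : ln s / ln b <= 1.
    by rewrite ler_pdivrMr// mul1r ler_ln// ?posrE.
  have ls0 : 0 <= ln s / ln b by rewrite divr_ge0// ?ln_ge0// ltW.
  have E0 (t : R) : (1 <= expR t) = (0 <= t) by rewrite -[in RHS]ler_expR expR0.
  have Es t : (expR t <= s) = (t <= ln s) by rewrite -[in RHS]ler_expR lnK// posrE.
  have FE : F @^-1` `[1, s]%classic = `[0, ln s / ln b]%classic.
    apply/seteqP; split=> y /=; rewrite !in_itv /= /f E0 pmulr_lge0// Es.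
      by rewrite -ler_pdivlMr.
    by rewrite -ler_pdivlMr.
  rewrite /distribution /pushforward/= FE /uniform_prob /=.
  rewrite (eq_integral (fun=> 1%E)); last first.
    move=> y; rewrite inE /= in_itv /= => /andP[y0 ys].
    by rewrite /uniform_pdf y0 (le_trans ys ls)/= subr0 invr1.
  rewrite integral_cst//= mul1e lebesgue_measure_itv/= lte_fin.
  by case: ltP => [_|]; [rewrite sube0|move=> ?; congr EFin; apply/esym/eqP; rewrite eq_le; apply/andP].
split; last by move=> s /andP[s1 /ltW sb]; exact: key.
by apply: etrans (key b (ltW b1) (lexx b)) _; rewrite divff// gt_eqF.
Qed.

(* Main.v *)
Require Import Defs.
From HB Require Import structures.
From mathcomp Require Import all_boot all_order all_algebra.
From mathcomp Require Import all_classical all_reals all_analysis.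
From mathcomp Require Import measurable_realfun ring lra.
Set Implicit Arguments.
Unset Strict Implicit.
Unset Printing Implicit Defensive.
Import Order.TTheory GRing.Theory Num.Theory.
Import numFieldNormedType.Exports.
Local Open Scope classical_set_scope.
Local Open Scope ring_scope.

(** The quantile function of beta_b is t |-> b^t = exp (L t) with L = ln b,
    and that of a discrete measure with sorted atoms x_j and cumulative weights
    P_j is the step function equal to x_j on the cell [P_(j-1), P_j[.  The
    Kantorovich distance to beta_b is therefore, up to the factor 1 / (b - 1),
    a sum over the cells of integrals of |exp (L t) - x_j|.

    On a single cell [u, v[ the best constant is the value of exp (L t) at the
    midpoint, its median there, and the resulting cost is
      (exp (L v / 2) - exp (L u / 2))^2 / L;
    this is [cell_cost_ge], and [cell_cost_eq] says that on a nonempty cell no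
    other constant does as well.  What remains is to choose the cells, and in
    the variables r_j = exp (L P_j / 2) this is elementary: the increments
    r_j - r_(j-1) have the fixed sum b^(1/2) - 1 and the sum of their squares
    has to be minimized.  By [sum_sqr_deviation] the minimum is
    (b^(1/2) - 1)^2 / n, attained exactly when the r_j are equally spaced.
    Equal spacing gives r_j = 1 + j/n (b^(1/2) - 1), hence the P_j, and the
    midpoint rule gives x_j = r_(j-1) r_j.  Uniqueness follows by reading off
    the equality cases of both inequalities ([total_cost_eqP]).  The tanh in
    the minimal distance comes from factoring b - 1 as
    (b^(1/2) - 1) (b^(1/2) + 1). *)

(** * Approximating the exponential by a constant on one cell *)

Section one_cell.
Context {R : realType} (L : R).
Hypothesis L_gt0 : 0 < L.
Implicit Types u v c : R.

(** The point of [u, v] nearest to the solution of exp (L t) = c.  Clamping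
    makes the cost formula below valid for all c > 0, with no case distinction
    on whether the graph crosses the level c inside the cell. *)
Definition split_point u v c : R := Num.max u (Num.min v (ln c / L)).

(** Inside the cell, exp (L t) is at most c to the left of the split point and
    at least c to its right.  The guards u < m and m < v are needed because a
    split point clamped to an end of the cell satisfies only one of the two
    comparisons. *)
Lemma split_pointP u v c : u <= v -> 0 < c ->
  let m := split_point u v c in
  [/\ u <= m <= v, u < m -> expR (L * m) <= c & m < v -> c <= expR (L * m)].
Proof.
move=> uv c0; have Ea : expR (L * (ln c / L)) = c.
  by rewrite mulrCA divff ?gt_eqF// mulr1 lnK.
have le_c t : t <= ln c / L -> expR (L * t) <= c.
  by move=> tc; rewrite -[leRHS]Ea ler_expR ler_pM2l.
have ge_c t : ln c / L <= t -> c <= expR (L * t).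
  by move=> tc; rewrite -[leLHS]Ea ler_expR ler_pM2l.
rewrite /split_point /=; split.
- by rewrite le_max lexx ge_max uv ge_min lexx.
- by rewrite lt_max ltxx /= => um; apply: le_c; rewrite max_r ?ge_min ?lexx ?orbT// ltW.
- rewrite gt_max gt_min ltxx /= => /andP[_ av].
  by apply: ge_c; rewrite min_r ?le_max ?lexx ?orbT// ltW.
Qed.

(** The integral of |exp (L t) - c| over the cell, evaluated by primitives on
    both sides of the split point. *)
Definition cell_cost u v c : R :=
  let m := split_point u v c in
  c * (m - u - (v - m)) + (expR (L * u) + expR (L * v) - 2 * expR (L * m)) / L.

Lemma continuous_exp_sub s c : continuous (fun t : R => s * (expR (L * t) - c)).
Proof. by move=> t; apply: differentiable_continuous; exact/derivable1_diffP. Qed.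

(** The factor s is the sign with which each half of a cell contributes to the
    integral of the absolute value. *)
Lemma integral_exp_sub s u v c : u <= v ->
  (\int[@lebesgue_measure R]_(t in `[u, v[) (s * (expR (L * t) - c))%:E)%E =
  (s * ((expR (L * v) - expR (L * u)) / L - c * (v - u)))%:E.
Proof.
rewrite le_eqVlt => /predU1P[<-|uv].
  by rewrite set_itvco0 integral_set0 !subrr mul0r mulr0 subrr mulr0.
pose f t : R := s * (expR (L * t) - c).
pose F t : R := s * (expR (L * t) / L - c * t).
have dF (t : R) : is_derive t 1 F (f t).
  rewrite /F /f; apply: is_derive_eq.
  by rewrite /GRing.scale /=; field; rewrite gt_eqF.
have cf : continuous f := @continuous_exp_sub s c.
have cF : continuous F.
  by move=> t; apply: differentiable_continuous; exact/derivable1_diffP.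
rewrite integral_itv_bndo_bndc; last first.
  apply/measurable_EFinP; apply: measurable_funTS.
  exact: continuous_measurable_fun.
rewrite (@continuous_FTC2 _ f F) //.
- by rewrite -EFinB /F; congr EFin; field; rewrite gt_eqF.
- exact: continuous_subspaceT.
- split; [by move=> t _; case: (dF t)| |].
    by apply: cvg_at_right_filter; exact: cF.
  by apply: cvg_at_left_filter; exact: cF.
- by move=> t _; rewrite derive1E; exact: derive_val.
Qed.

Lemma measurable_cell u v c : measurable_fun `[u, v[
  (fun t : R => (`|expR (L * t) - c|)%:E).
Proof.
apply/measurable_EFinP; apply: measurable_funTS; apply: measurableT_comp => //.
apply: continuous_measurable_fun.
by have := @continuous_exp_sub 1 c; under eq_fun do rewrite mul1r.
Qed.

Lemma integral_cell u v c : u <= v -> 0 < c ->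
  (\int[@lebesgue_measure R]_(t in `[u, v[) (`|expR (L * t) - c|)%:E)%E =
  (cell_cost u v c)%:E.
Proof.
move=> uv c0; rewrite /cell_cost; have [] := split_pointP uv c0.
set m := split_point u v c => /andP[um mv] lem gem.
have -> : `[u, v[%classic = `[u, m[%classic `|` `[m, v[%classic.
  by rewrite -itv_bndbnd_setU// bnd_simp.
rewrite ge0_integral_setU//=; last 2 first.
- by apply/measurable_funU => //; split; exact: measurable_cell.
- apply/disj_set2P/seteqP; split=> // t [] /=; rewrite !in_itv /=.
  by move=> /andP[_ tm] /andP[mt _]; rewrite ltNge mt in tm.
have -> : (\int[@lebesgue_measure R]_(t in `[u, m[) (`|expR (L * t) - c|)%:E)%E =
    (-1 * ((expR (L * m) - expR (L * u)) / L - c * (m - u)))%:E.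
  rewrite -integral_exp_sub//; apply: eq_integral => t.
  rewrite inE /= in_itv /= => /andP[ut tm].
  rewrite mulN1r ler0_norm// subr_le0 (le_trans _ (lem (le_lt_trans ut tm)))//.
  by rewrite ler_expR ler_pM2l// ltW.
have -> : (\int[@lebesgue_measure R]_(t in `[m, v[) (`|expR (L * t) - c|)%:E)%E =
    (1 * ((expR (L * v) - expR (L * m)) / L - c * (v - m)))%:E.
  rewrite -integral_exp_sub//; apply: eq_integral => t.
  rewrite inE /= in_itv /= => /andP[mt tv].
  rewrite mul1r ger0_norm// subr_ge0 (le_trans (gem (le_lt_trans mt tv)))//.
  by rewrite ler_expR ler_pM2l.
by rewrite -EFinD; congr EFin; field; rewrite gt_eqF.
Qed.

(** With m the split point and mid the midpoint, the excess over the claimed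
    minimum is a sum of two terms: the first is nonnegative because c lies
    weakly on the same side of exp (L m) as m does of mid, the second because
    the exponential lies above its tangent at 0. *)
Lemma cell_costE u v c : let m := split_point u v c in let mid := (u + v) / 2 in
  cell_cost u v c - (expR (L * v / 2) - expR (L * u / 2)) ^+ 2 / L =
  2 * ((m - mid) * (c - expR (L * m))) +
  2 / L * (expR (L * m) * (expR (L * (mid - m)) - (1 + L * (mid - m)))).
Proof.
rewrite /cell_cost; set m := split_point _ _ _ => /=.
have E2 t : expR (L * t) = expR (L * t / 2) ^+ 2.
  by rewrite -expRM_natl; congr expR; field.
have -> : expR (L * m) * (expR (L * ((u + v) / 2 - m)) - (1 + L * ((u + v) / 2 - m))) =
    expR (L * u / 2) * expR (L * v / 2) - expR (L * m) * (1 + L * ((u + v) / 2 - m)).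
  by rewrite mulrBr -!expRD; congr (expR _ - _); field.
rewrite (E2 u) (E2 v); field; by rewrite gt_eqF.
Qed.

Lemma cell_cost_terms_ge0 u v c : u <= v -> 0 < c ->
  let m := split_point u v c in let mid := (u + v) / 2 in
  0 <= (m - mid) * (c - expR (L * m)) /\
  0 <= expR (L * m) * (expR (L * (mid - m)) - (1 + L * (mid - m))).
Proof.
move=> uv c0; have [] := split_pointP uv c0.
set m := split_point u v c => /= /andP[um mv] lem gem; split; last first.
  by rewrite mulr_ge0 ?expR_ge0// subr_ge0 expR_ge1Dx.
have [mm|mm|->] := ltgtP m ((u + v) / 2); last by rewrite subrr mul0r.
- by rewrite mulr_le0// subr_le0 ?(ltW mm)// gem//; lra.
- by rewrite mulr_ge0// subr_ge0 ?(ltW mm)// lem//; lra.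
Qed.

Lemma cell_cost_ge u v c : u <= v -> 0 < c ->
  (expR (L * v / 2) - expR (L * u / 2)) ^+ 2 / L <= cell_cost u v c.
Proof.
move=> uv c0; rewrite -subr_ge0 cell_costE.
have [h1 h2] := cell_cost_terms_ge0 uv c0.
apply: addr_ge0; first exact: mulr_ge0.
by apply: mulr_ge0 => //; rewrite divr_ge0// ltW.
Qed.

(** The tangent inequality is strict away from 0, so an optimal cell has its
    split point at the midpoint; this is interior when u < v, so the clamping is
    inactive and c is the value of exp (L t) there. *)
Lemma cell_cost_eq u v c : u < v -> 0 < c ->
  (cell_cost u v c == (expR (L * v / 2) - expR (L * u / 2)) ^+ 2 / L) =
  (c == expR (L * u / 2) * expR (L * v / 2)).
Proof.
move=> uv c0; have uv' := ltW uv; rewrite -subr_eq0 cell_costE.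
have [h1 h2] := cell_cost_terms_ge0 uv' c0.
have [] := split_pointP uv' c0.
have L2 : 0 < 2 / L by rewrite divr_gt0.
have -> : expR (L * u / 2) * expR (L * v / 2) = expR (L * ((u + v) / 2)).
  by rewrite -expRD; congr expR; field.
move: h1 h2; set m := split_point u v c => /= h1 h2 /andP[um mv] lem gem.
have cancel_pos (k t : R) : 0 < k -> (k * t == 0) = (t == 0).
  by move=> k0; rewrite mulf_eq0 gt_eqF.
rewrite paddr_eq0; [|exact: mulr_ge0|exact: mulr_ge0 (ltW L2) h2].
rewrite (cancel_pos 2)// (cancel_pos (2 / L))// (cancel_pos (expR _)) ?expR_gt0//.
apply/andP/eqP => [[_ /eqP E]|cE].
  have /eqP : L * ((u + v) / 2 - m) = 0.
    by apply/eqP/negPn/negP => /expR_gt1Dx; rewrite -subr_gt0 E ltxx.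
  rewrite mulf_eq0 gt_eqF//= subr_eq0 => /eqP mE.
  rewrite mE; apply/eqP; rewrite eq_le lem ?gem//; lra.
have -> : m = (u + v) / 2.
  rewrite /m /split_point cE expRK mulrAC divff ?gt_eqF// mul1r.
  by rewrite min_r ?max_r//; lra.
by rewrite cE !subrr !mulr0 expR0 addr0 subrr !eqxx.
Qed.

End one_cell.

(** * Quantile functions and the distance as a sum over cells *)

Section quantiles.
Context {R : realType}.
Implicit Types mu nu : prob R.

Lemma eq_meas_d1 (b : R) mu nu nu' : eq_meas nu nu' -> d1 b mu nu = d1 b mu nu'.
Proof.
move=> nunu'; suff E : quantile nu = quantile nu' by rewrite /d1 E.
apply/funext => y; rewrite /quantile; congr sup; apply/seteqP.
by split=> x /=; rewrite /distr_fun nunu'.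
Qed.

(** Full mass on [1, b] makes everything outside that interval null, which
    extends the prescribed values on the [1, s] to the whole line. *)
Lemma distr_fun_beta (b : R) (beta : prob R) x : 1 < b -> is_beta b beta ->
  distr_fun beta x =
  if x < 1 then 0 else if x < b then ln x / ln b else 1.
Proof.
move=> b1 [beta1 betas]; rewrite /distr_fun.
have null A : measurable A -> A `<=` ~` `[1, b] -> beta A = 0%E.
  move=> mA sA; apply/eqP; rewrite -measure_le0.
  have <- : beta (~` `[1, b]) = 0%E by rewrite probability_setC// beta1 subee.
  by apply: le_measure; rewrite ?inE//; exact: measurableC.
case: ltP => [x1|x1].
  rewrite null// => y /=; rewrite !in_itv /= => yx /andP[y1 _]; lra.
case: ltP => [xb|bx].
  have -> : `]-oo, x]%classic = `]-oo, 1[%classic `|` `[1, x]%classic.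
    by rewrite -itv_bndbnd_setU// bnd_simp.
  rewrite measureU//; last first.
    apply/seteqP; split=> // t [] /=; rewrite !in_itv /= => t1 /andP[]; lra.
  rewrite [X in (X + _)%E]null//; last first.
    by move=> y /=; rewrite !in_itv /= => yx /andP[y1 _]; lra.
  have x1b : 1 <= x < b by rewrite x1.
  by rewrite add0e; have := congr1 fine (betas x x1b) => /= ->.
suff -> : beta `]-oo, x]%classic = 1%E by [].
apply/eqP; rewrite eq_le probability_le1//= -beta1.
apply: le_measure; rewrite ?inE// => y /=; rewrite !in_itv /= => /andP[_]; lra.
Qed.

Lemma quantile_beta (b : R) (beta : prob R) y : 1 < b -> is_beta b beta ->
  0 <= y < 1 -> quantile beta y = expR (ln b * y).
Proof.
move=> b1 hbeta /andP[y0 y1]; have L0 : 0 < ln b by rewrite ln_gt0.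
rewrite /quantile [X in sup X](_ : _ = `]-oo, expR (ln b * y)]%classic).
  by rewrite sup_itv// bnd_simp.
have E1 : 1 <= expR (ln b * y) by rewrite -expR0 ler_expR mulr_ge0// ltW.
have Eb : expR (ln b * y) < b.
  by rewrite -[ltRHS]lnK ?posrE ?(lt_trans _ b1)// ltr_expR gtr_pMr.
apply/seteqP; split=> x /=; rewrite in_itv /= (distr_fun_beta _ b1 hbeta).
  case: ltP => [x1 _|x1]; first lra.
  case: ltP => [xb|bx]; last lra.
  by rewrite ler_pdivrMr// mulrC -ler_expR lnK// posrE; lra.
move=> xE; case: ltP => [//|x1]; case: ltP => [xb|bx]; last lra.
by rewrite ler_pdivrMr// mulrC -ler_expR lnK// posrE; lra.
Qed.

Definition cumul {n : nat} (p : 'I_n -> R) (k : nat) : R :=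
  \sum_(i < n | (i < k)%N) p i.

Lemma cumul0 n (p : 'I_n -> R) : cumul p 0 = 0.
Proof. by rewrite /cumul big_pred0. Qed.

Lemma cumul_full n (p : Pi R n) : cumul p n = 1.
Proof. by rewrite -(weight_sum1 p) /cumul; apply: eq_bigl => i; rewrite ltn_ord. Qed.

Lemma cumulS n (p : 'I_n -> R) (j : 'I_n) : cumul p j.+1 = cumul p j + p j.
Proof.
rewrite /cumul (bigD1 j)//= addrC; congr (_ + _); apply: eq_bigl => i.
by rewrite ltnS [RHS]ltn_neqAle andbC.
Qed.

Lemma cumul_le n (p : Pi R n) k : cumul p k <= cumul p k.+1.
Proof.
rewrite /cumul [leRHS](bigID (fun i : 'I_n => (i < k)%N))/=.
rewrite [X in _ <= X + _](eq_bigl (fun i : 'I_n => (i < k)%N)); last first.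
  by move=> i /=; case: (ltnP i k) => ik; rewrite ?andbF// andbT ltnS ltnW.
by rewrite lerDl sumr_ge0// => i _; exact: weight_ge0.
Qed.

Lemma distr_fun_delta n (x : 'I_n -> R) (p : Pi R n) t :
  distr_fun (delta x p) t = \sum_(j < n | x j <= t) p j.
Proof.
rewrite /distr_fun /= /delta (eq_bigr (fun j => (p j * (x j <= t)%R%:R)%:E)).
  rewrite sumEFin /= big_mkcond [RHS]big_mkcond /=; apply: eq_bigr => j _.
  by case: ifP; rewrite ?mulr1 ?mulr0.
move=> j _; rewrite diracE EFinM; congr (_ * ((nat_of_bool _)%:R)%:E)%E.
by apply/idP/idP; rewrite inE /= in_itv.
Qed.

(** Because the atoms are sorted, a point a < x_j has only atoms of index less
    than j on its left, while a point a >= x_j has at least those of index up to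
    j; hence the distribution function is at most t exactly on ]-oo, x_j[. *)
Lemma quantile_delta n (x : 'I_n -> R) (p : Pi R n) (j : 'I_n) t :
  (forall i k : 'I_n, (i <= k)%N -> x i <= x k) ->
  cumul p j <= t < cumul p j.+1 -> quantile (delta x p) t = x j.
Proof.
move=> xmono /andP[jt tj].
rewrite /quantile [X in sup X](_ : _ = `]-oo, x j[%classic).
  by rewrite sup_itv// bnd_simp.
have sub (P Q : pred 'I_n) : subpred P Q ->
    \sum_(i < n | P i) p i <= \sum_(i < n | Q i) p i.
  move=> PQ; rewrite big_mkcond [leRHS]big_mkcond; apply: ler_sum => i _.
  by case: ifP => [/PQ ->//|_]; case: ifP => // _; exact: weight_ge0.
apply/seteqP; split=> a /=; rewrite in_itv /= distr_fun_delta => h.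
  rewrite ltNge; apply/negP => xa; have := lt_le_trans tj (sub _ _ _ : _ <= _).
  move=> /(_ (fun i => x i <= a)) /(_ _)/(le_lt_trans h).
  rewrite ltxx; move=> H; suff : false by []; apply: H => i.
  by rewrite ltnS => /xmono /le_trans; apply.
apply: le_trans jt; apply: sub => i xi; rewrite ltnNge; apply/negP => /xmono.
by move=> /(lt_le_trans h) /lt_le_trans /(_ xi); rewrite ltxx.
Qed.

(** Measurability is part of the conclusion because the induction needs it for
    the union of the cells already treated. *)
Lemma integral_itv_partition (W : nat -> R) (f : R -> \bar R) N :
  (forall k, W k <= W k.+1) -> (forall t, (0 <= f t)%E) ->
  (forall k, (k < N)%N -> measurable_fun `[W k, W k.+1[ f) ->
  measurable_fun `[W 0%N, W N[ f /\
  (\int[@lebesgue_measure R]_(t in `[W 0%N, W N[) f t =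
   \sum_(k < N) \int[@lebesgue_measure R]_(t in `[W k, W k.+1[) f t)%E.
Proof.
move=> Wm f0; elim: N => [_|N IH mf].
  by rewrite set_itvco0 integral_set0 big_ord0; split=> //; exact: measurable_fun_set0.
have [k kN|mN IN] := IH; first by apply: mf; exact: ltnW.
have W0N : W 0%N <= W N by elim: {IH mf mN IN} N => // N /le_trans; apply.
have E : `[W 0%N, W N.+1[%classic = `[W 0%N, W N[%classic `|` `[W N, W N.+1[%classic.
  by rewrite -itv_bndbnd_setU// bnd_simp.
have mU : measurable_fun `[W 0%N, W N.+1[ f.
  by rewrite E; apply/measurable_funU => //; split=> //; exact: mf.
split=> //; rewrite big_ord_recr/= -IN E ge0_integral_setU// -?E//.
apply/disj_set2P/seteqP; split=> // t [] /=; rewrite !in_itv /=.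
by move=> /andP[_ tm] /andP[mt _]; rewrite ltNge mt in tm.
Qed.

Lemma d1_beta_delta (b : R) (beta : prob R) n (x : 'I_n -> R) (p : Pi R n) :
  1 < b -> is_beta b beta -> Xi b x ->
  d1 b beta (delta x p) =
  ((b - 1)^-1 *
    \sum_(j < n) cell_cost (ln b) (cumul p j) (cumul p j.+1) (x j))%:E.
Proof.
move=> b1 hbeta [xb xmono]; have L0 : 0 < ln b by rewrite ln_gt0.
rewrite /d1 EFinM; congr (_ * _)%E.
pose f t := (`|quantile beta t - quantile (delta x p) t|)%:E.
have cumul_ge0 k : 0 <= cumul p k.
  by apply: sumr_ge0 => i _; exact: weight_ge0.
have cumul_le1 k : (k <= n)%N -> cumul p k <= 1.
  by rewrite -(cumul_full p); apply: (homo_leq lexx le_trans (cumul_le p)).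
have fE (j : 'I_n) t : t \in `[cumul p j, cumul p j.+1[%classic ->
    f t = (`|expR (ln b * t) - x j|)%:E.
  rewrite inE /= in_itv /= => tj; rewrite /f (quantile_delta xmono tj).
  move/andP: tj => [jt tj]; rewrite (quantile_beta b1 hbeta)//.
  by rewrite (le_trans _ jt)//= (lt_le_trans tj)// cumul_le1.
have [|||_] := @integral_itv_partition (cumul p) f n.
- exact: cumul_le.
- by move=> t; rewrite lee_fin.
- move=> k kn.
  apply: eq_measurable_fun (@measurable_cell _ (ln b) _ _ (x (Ordinal kn))).
  by move=> t tk; rewrite (fE (Ordinal kn)).
rewrite cumul0 cumul_full => ->; rewrite -sumEFin; apply: eq_bigr => j _.
transitivity (\int[@lebesgue_measure R]_(t in `[cumul p j, cumul p j.+1[)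
    (`|expR (ln b * t) - x j|)%:E)%E.
  by apply: eq_integral => t /fE.
rewrite integral_cell ?cumul_le//.
by case/andP: (xb j) => /(lt_le_trans ltr01).
Qed.

End quantiles.

(** * The optimal cells *)

(** The variance identity, which is the inequality of Cauchy and Schwarz for a
    constant vector together with its equality case. *)
Lemma sum_sqr_deviation (F : numFieldType) n (d : 'I_n -> F) : (0 < n)%N ->
  \sum_j d j ^+ 2 =
  (\sum_j d j) ^+ 2 / n%:R + \sum_j (d j - (\sum_j d j) / n%:R) ^+ 2.
Proof.
move=> n0; set D := \sum_j d j; have n0' : n%:R != 0 :> F by rewrite pnatr_eq0 -lt0n.
rewrite [X in _ + X](eq_bigr (fun j =>
  d j ^+ 2 + (d j * - (2 * D / n%:R) + (D / n%:R) ^+ 2))) => [|j _]; last by ring.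
rewrite !big_split/= -mulr_suml sumr_const card_ord -mulr_natl -/D.
by field.
Qed.

Section optimization.
Context {R : realType} (b : R) (n : nat).
Hypotheses (b_gt1 : 1 < b) (n_gt0 : (0 < n)%N).
Implicit Types (x : 'I_n -> R) (p : Pi R n).
Local Notation L := (ln b).
Local Notation D := (b `^ (1 / 2) - 1).

(** The equally spaced values of b to the power P_j / 2 for the optimal
    measure. *)
Definition knot (k : nat) : R := 1 + k%:R / n%:R * D.

Let L_gt0 : 0 < L. Proof. by rewrite ln_gt0. Qed.
Let n_neq0 : n%:R != 0 :> R. Proof. by rewrite pnatr_eq0 -lt0n. Qed.
Let n_pos : 0 < n%:R :> R. Proof. by rewrite ltr0n. Qed.

Lemma sqrt_exp : b `^ (1 / 2) = expR (L / 2).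
Proof. by rewrite /powR gt_eqF ?(lt_trans _ b_gt1)//; congr expR; field. Qed.

Lemma D_gt0 : 0 < D.
Proof. by rewrite sqrt_exp subr_gt0 expR_gt1 divr_gt0. Qed.

Lemma knot0 : knot 0 = 1. Proof. by rewrite /knot !mul0r addr0. Qed.

Lemma knot_full : knot n = expR (L / 2).
Proof. by rewrite /knot sqrt_exp divff// mul1r addrC subrK. Qed.

Lemma knotS k : knot k.+1 - knot k = D / n%:R.
Proof. by rewrite /knot -natr1; field. Qed.

Lemma knot_lt k l : (knot k < knot l) = (k < l)%N.
Proof. by rewrite /knot ltrD2l ltr_pM2r ?D_gt0// ltr_pM2r ?invr_gt0// ltr_nat. Qed.

Lemma knot_ge1 k : 1 <= knot k.
Proof. by rewrite /knot lerDl mulr_ge0 ?divr_ge0// ltW// D_gt0. Qed.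

Lemma knot_gt0 k : 0 < knot k.
Proof. exact: lt_le_trans (knot_ge1 k). Qed.

(** The change of variables that turns the cost of an optimally filled cell
    into the square of an increment. *)
Definition root_node p (k : nat) : R := expR (L * cumul p k / 2).

Lemma sum_root_node p : \sum_(j < n) (root_node p j.+1 - root_node p j) = D.
Proof.
rewrite -(big_mkord xpredT (fun k => root_node p k.+1 - root_node p k)).
by rewrite telescope_sumr// /root_node cumul_full cumul0 mulr1 mulr0 mul0r expR0 sqrt_exp.
Qed.

Definition total_cost x p : R :=
  \sum_(j < n) cell_cost L (cumul p j) (cumul p j.+1) (x j).

Definition balanced x p : Prop := forall j : 'I_n,
  root_node p j.+1 - root_node p j = D / n%:R /\
  x j = root_node p j * root_node p j.+1.

(** The two nonnegative parts of each summand measure the two ways of being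
    suboptimal: a misplaced atom in its cell, and unequal increments. *)
Lemma total_cost_excess x p :
  total_cost x p - D ^+ 2 / (n%:R * L) =
  \sum_(j < n) ((cell_cost L (cumul p j) (cumul p j.+1) (x j) -
     (root_node p j.+1 - root_node p j) ^+ 2 / L) +
   (root_node p j.+1 - root_node p j - D / n%:R) ^+ 2 / L).
Proof.
rewrite big_split/= sumrB -!mulr_suml.
rewrite (sum_sqr_deviation (fun j : 'I_n => root_node p j.+1 - root_node p j))//.
by rewrite sum_root_node /total_cost; field; rewrite n_neq0 gt_eqF.
Qed.

Lemma cell_excess_ge0 x p (j : 'I_n) : Xi b x ->
  0 <= cell_cost L (cumul p j) (cumul p j.+1) (x j) -
     (root_node p j.+1 - root_node p j) ^+ 2 / L.
Proof.
move=> [xb _]; rewrite subr_ge0 cell_cost_ge ?cumul_le//.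
by case/andP: (xb j) => /(lt_le_trans ltr01).
Qed.

Lemma total_cost_ge x p : Xi b x -> D ^+ 2 / (n%:R * L) <= total_cost x p.
Proof.
move=> xXi; rewrite -subr_ge0 total_cost_excess sumr_ge0// => j _.
by rewrite addr_ge0 ?cell_excess_ge0// divr_ge0 ?sqr_ge0 ?ltW.
Qed.

Lemma root_node_lt p k l : (root_node p k < root_node p l) = (cumul p k < cumul p l).
Proof. by rewrite /root_node ltr_expR ltr_pM2r ?invr_gt0// ltr_pM2l. Qed.

(** Equal increments are positive, so no cell is empty and the rigidity of each
    single cell applies. *)
Lemma total_cost_eqP x p : Xi b x ->
  total_cost x p = D ^+ 2 / (n%:R * L) <-> balanced x p.
Proof.
move=> xXi; have x0 j : 0 < x j.
  by case: xXi => xb _; case/andP: (xb j) => /(lt_le_trans ltr01).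
have lt_cumul j : root_node p j.+1 - root_node p j = D / n%:R ->
    cumul p j < cumul p j.+1.
  by move=> E; rewrite -root_node_lt -subr_gt0 E divr_gt0// D_gt0.
split=> [E j|bal].
  have : total_cost x p - D ^+ 2 / (n%:R * L) = 0 by rewrite E subrr.
  rewrite total_cost_excess => /(psumr_eq0P (fun i _ => addr_ge0
    (cell_excess_ge0 p i xXi) (divr_ge0 (sqr_ge0 _) (ltW L_gt0)))).
  move=> /(_ j isT)/eqP.
  rewrite paddr_eq0 ?cell_excess_ge0 ?divr_ge0 ?sqr_ge0 ?ltW//.
  rewrite mulf_eq0 invr_eq0 (gt_eqF L_gt0) orbF sqrf_eq0 subr_eq0 subr_eq0.
  move=> /andP[cE /eqP dE]; split=> //; move: cE.
  by rewrite cell_cost_eq ?lt_cumul// => /eqP.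
apply/eqP; rewrite -subr_eq0 total_cost_excess big1// => j _.
have [dE xE] := bal j; rewrite {2}dE subrr expr0n mul0r addr0; apply/eqP.
by rewrite subr_eq0 cell_cost_eq ?lt_cumul// xE.
Qed.

Lemma root_node_knot p k : root_node p k = knot k -> cumul p k = 2 / L * ln (knot k).
Proof. by move=> <-; rewrite /root_node expRK; field; rewrite gt_eqF. Qed.

Lemma balanced_knot x p : balanced x p ->
  (forall k, (k <= n)%N -> cumul p k = 2 / L * ln (knot k)) /\
  forall j, x j = knot j * knot j.+1.
Proof.
move=> bal; have E k : (k <= n)%N -> root_node p k = knot k.
  elim: k => [|k IH] kn.
    by rewrite knot0 /root_node cumul0 mulr0 mul0r expR0.
  have [dE _] := bal (Ordinal kn); move: dE => /= /eqP.
  by rewrite subr_eq => /eqP ->; rewrite IH ?(ltnW kn)// -(knotS k) subrK.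
split=> [k kn|j]; first exact/root_node_knot/E.
by have [_ ->] := bal j; rewrite !E ?(ltnW (ltn_ord j)).
Qed.

Lemma knot_balanced x p :
  (forall k, (k <= n)%N -> cumul p k = 2 / L * ln (knot k)) ->
  (forall j, x j = knot j * knot j.+1) -> balanced x p.
Proof.
move=> cE xE; have E k : (k <= n)%N -> root_node p k = knot k.
  move=> kn; rewrite /root_node cE// -[RHS]lnK ?posrE ?knot_gt0//; congr expR.
  by field; rewrite gt_eqF.
by move=> j; rewrite xE !E ?(ltnW (ltn_ord j))// knotS.
Qed.

Definition opt_weight (j : 'I_n) : R := 2 / L * (ln (knot j.+1) - ln (knot j)).

Lemma opt_weight_gt0 j : 0 < opt_weight j.
Proof.
by rewrite mulr_gt0 ?divr_gt0// subr_gt0 ltr_ln ?posrE ?knot_gt0// knot_lt.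
Qed.

Lemma cumul_opt_weight k : (k <= n)%N -> cumul opt_weight k = 2 / L * ln (knot k).
Proof.
elim: k => [|k IH] kn; first by rewrite cumul0 knot0 ln1 mulr0.
rewrite (cumulS opt_weight (Ordinal kn)) /= IH ?(ltnW kn)//.
by rewrite /opt_weight/= mulrBr addrC subrK.
Qed.

Lemma opt_weight_sum1 : \sum_(j < n) opt_weight j = 1.
Proof.
have <- : cumul opt_weight n = \sum_(j < n) opt_weight j.
  by apply: eq_bigl => i; rewrite ltn_ord.
by rewrite cumul_opt_weight// knot_full expRK; field; rewrite gt_eqF.
Qed.

Definition opt_Pi : Pi R n := MkPi (fun j => ltW (opt_weight_gt0 j)) opt_weight_sum1.

Definition opt_atom (j : 'I_n) : R := knot j * knot j.+1.

Lemma opt_atom_lt (i j : 'I_n) : (i < j)%N -> opt_atom i < opt_atom j.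
Proof. by move=> ij; rewrite /opt_atom ltr_pM ?knot_lt// ltW// knot_gt0. Qed.

Lemma opt_atom_inj : injective opt_atom.
Proof.
move=> i j xij; case: (ltngtP i j) => [/opt_atom_lt|/opt_atom_lt|/val_inj//].
  by rewrite xij ltxx.
by rewrite xij ltxx.
Qed.

Lemma opt_atom_Xi : Xi b opt_atom.
Proof.
have bE : b = knot n * knot n.
  by rewrite knot_full -expRD -mulrDr -div1r -splitr mulr1 lnK// posrE (lt_trans _ b_gt1).
have knot_le k : (k <= n)%N -> knot k <= knot n.
  by move=> kn; rewrite leNgt knot_lt -leqNgt.
split=> [j|i j]; last first.
  by rewrite leq_eqVlt => /predU1P[/val_inj->//|/opt_atom_lt/ltW].
rewrite /opt_atom mulr_ege1 ?knot_ge1//= [leRHS]bE.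
by rewrite ler_pM ?knot_le ?(ltW (knot_gt0 _))// ltnW.
Qed.

Lemma opt_cost_tanh :
  (b - 1)^-1 * (D ^+ 2 / (n%:R * L)) = (n%:R * L)^-1 * tanh (L / 4).
Proof.
rewrite /tanh expRN sqrt_exp; set e := expR (L / 4).
have e1 : 1 < e by rewrite expR_gt1 divr_gt0.
have -> : expR (L / 2) = e ^+ 2 by rewrite -expRM_natl; congr expR; field.
have -> : b - 1 = e ^+ 4 - 1.
  by rewrite -expRM_natl mulrC divfK// lnK// posrE (lt_trans _ b_gt1).
have L0 : L != 0 by rewrite gt_eqF.
have e0 : 0 < e := expR_gt0 _.
field; rewrite L0 n_neq0 /=; apply/and3P; split; rewrite gt_eqF//.
  by rewrite addr_gt0// mulr_gt0.
by rewrite subr_gt0 exprn_egt1.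
Qed.

End optimization.

(** * The support of a discrete measure *)

Section support.
Context {R : realType} {n : nat} (x : 'I_n -> R) (p : Pi R n).

(** The complement of the finite set of atoms is an open null set. *)
Lemma msupp_delta : (forall j, 0 < p j) -> msupp (delta x p) = range x.
Proof.
move=> p0; apply/seteqP; split=> [a supp_a|_ [j _ <-] U _ Uxj].
  apply: contrapT => xa.
  have oU : open (~` range x).
    apply: closed_openC; apply: accessible_finite_set_closed.1.
      exact/hausdorff_accessible/norm_hausdorff.
    exact: finite_image.
  have := supp_a _ oU xa; rewrite /= /delta big1 ?ltxx// => j _.
  by rewrite diracE memNset ?mule0//; apply; exists j.
rewrite /= /delta (bigD1 j)//= diracE mem_set// mule1.
rewrite (@lt_le_trans _ _ (p j)%:E) ?lte_fin// leeDl// sume_ge0// => i _.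
by rewrite mule_ge0// lee_fin weight_ge0.
Qed.

Lemma card_range_ord : injective x -> (range x #= `I_n)%card.
Proof.
move=> xinj; apply: card_eq_trans (inj_card_eq _) _; first by move=> ? ? _ _ /xinj.
rewrite card_eq_sym; apply: card_eq_trans (inj_card_eq (f := @nat_of_ord n) _).
  suff -> : `I_n = range (@nat_of_ord n) by exact: card_eqxx.
  by apply/seteqP; split=> [k kn|_ [i _ <-] //=]; exists (Ordinal kn).
by move=> ? ? _ _ /val_inj.
Qed.

End support.

(** * The best approximation *)

Theorem corollary4p4 (R : realType) (b : R) (n : nat) (beta : prob R) :
  1 < b -> (0 < n)%N -> is_beta b beta ->
  exists (x : 'I_n -> R) (p : Pi R n),
    (forall j : 'I_n,
      x j = (1 + j%:R / n%:R * (b `^ (1 / 2) - 1)) *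
            (1 + j.+1%:R / n%:R * (b `^ (1 / 2) - 1)) /\
      psum p j = 2 / ln b * ln (1 + j.+1%:R / n%:R * (b `^ (1 / 2) - 1))) /\
    Xi b x /\
    best_d1_approx b n beta (delta x p) /\
    (forall nu : prob R, best_d1_approx b n beta nu ->
      eq_meas nu (delta x p)) /\
    (msupp (delta x p) #= `I_n)%card /\
    d1 b beta (delta x p) = ((n%:R * ln b)^-1 * tanh (ln b / 4))%:E.
Proof.
move=> b1 n0 hbeta.
pose p := opt_Pi b1 n0; pose x : 'I_n -> R := @opt_atom R b n.
have xXi : Xi b x by exact: opt_atom_Xi.
have pE k : (k <= n)%N -> cumul p k = 2 / ln b * ln (knot b n k).
  exact: cumul_opt_weight.
have b10 : 0 < (b - 1)^-1 by rewrite invr_gt0 subr_gt0.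
have d1E (y : 'I_n -> R) q : Xi b y ->
    d1 b beta (delta y q) = ((b - 1)^-1 * total_cost b y q)%:E.
  exact: d1_beta_delta.
have xp_opt : total_cost b x p = (b `^ (1 / 2) - 1) ^+ 2 / (n%:R * ln b).
  by apply/total_cost_eqP => //; exact: knot_balanced.
have xp_best (y : 'I_n -> R) (q : Pi R n) : Xi b y ->
    (d1 b beta (delta x p) <= d1 b beta (delta y q))%E.
  by move=> yXi; rewrite !d1E// lee_fin ler_pM2l// xp_opt total_cost_ge.
exists x, p; split; [|split; [|split; [split|split; [|split]]]].
- move=> j; split; first by rewrite /x /opt_atom /knot.
  by rewrite -[RHS](pE j.+1).
- exact: xXi.
- by exists x, p; split.
- exact: xp_best.
- move=> nu [[y [q [yXi nuE]]] nu_best] A mA; rewrite nuE//.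
  have := nu_best x p xXi; rewrite (eq_meas_d1 b beta nuE) !d1E// lee_fin.
  rewrite ler_pM2l// xp_opt => y_le.
  have /total_cost_eqP : total_cost b y q = (b `^ (1 / 2) - 1) ^+ 2 / (n%:R * ln b).
    by apply: le_anti; rewrite y_le total_cost_ge.
  move=> /(_ b1 n0 yXi)/(balanced_knot b1 n0)[qE yE].
  have -> : y = x by apply/funext => j; rewrite yE.
  rewrite /= /delta; apply: eq_bigr => j _; congr (_%:E * _)%E.
  have := cumulS q j; rewrite !qE ?(ltnW (ltn_ord j))// -!pE ?(ltnW (ltn_ord j))//.
  by rewrite cumulS => /addrI.
- rewrite msupp_delta; last by move=> j; exact: opt_weight_gt0.
  by apply: card_range_ord; exact: opt_atom_inj.
- by rewrite d1E// xp_opt opt_cost_tanh.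
Qed.
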